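(* Consider the signaling game described in the context, in which customers care about fairness and rationally infer costs. There is a pure-strategy perfect Bayesian equilibrium (PBE) in which the monopoly uses the markup $M=\varepsilon/(\varepsilon-1)$, that is, $P(C)=\frac{\varepsilon}{\varepsilon-1}C$ for every marginal cost $C\in[0,C^h]$, and customers learn marginal cost from price, that is, $C^p(P(C))=C$. In this PBE, the cost passthrough is $\beta=\frac{d\ln P}{d\ln C}=1$. Hence, in this PBE, the markup and cost passthrough are the same as without fairness concerns, i.e. when $F\equiv 1$ (in which case the monopoly's markup is $\varepsilon/(\varepsilon-1)$ and the cost passthrough is $1$).
   Context: Let $\varepsilon>1$. A monopoly with constant marginal cost $C$ sells a good at a single price $P$ to a representative customer. Having observed $P$, the customer perceives marginal cost $C^p(P)$ and hence markup $M^p(P)=P/C^p(P)$. Given the fairness factor $F=F(M^p(P))$, the customer chooses purchases $Y$ to maximize $\frac{\varepsilon}{\varepsilon-1}(F\cdot Y)^{(\varepsilon-1)/\varepsilon}+W-P\cdot Y$, where $W>0$ is initial wealth; this gives the demand $Y^d(P)=P^{-\varepsilon}F(M^p(P))^{\varepsilon-1}$. The monopoly's profits are $(P-C)\cdot Y$. Customers care about fairness: the fairness function $F$ is twice differentiable, and is positive, strictly decreasing, and weakly concave on $[0,M^h]$, where $F(M^h)=0$ (so positivity is meant on $[0,M^h)$) and $M^h>\varepsilon/(\varepsilon-1)$. Perceived markups above $M^h$, including the infinite perceived markup arising when $C^p(P)=0$, give a fairness factor of $0$. Signaling game: $[0,C^h]$ is the set of all possible marginal costs. The monopoly knows its marginal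 cost $C\in[0,C^h]$; customers do not, and have non-atomistic prior beliefs over $[0,C^h]$. The monopoly learns its marginal cost and chooses a price; customers then observe the price, but not the marginal cost, and formulate demand. A pure-strategy PBE comprises: a pure strategy for the monopoly, $P:[0,C^h]\to\mathbb{R}_+$, selecting a price for every possible marginal cost; a belief function for customers, $C^p:\mathbb{R}_+\to[0,C^h]$, determining a (deterministic) perceived marginal cost for every possible price; and a pure strategy for customers, $Y^d:\mathbb{R}_+\to\mathbb{R}_+$, selecting a quantity purchased for every possible price; such that customers' demand is optimal given their beliefs, the monopoly's strategy maximizes its profits $(P-C)Y^d(P)$ given customers' beliefs and demand, and customers' beliefs are correct given the monopoly's strategy at every price on the equilibrium path (off-path beliefs are unrestricted).
   Formalization: At marginal cost C=0 no profit-maximizing price exists, so exact profit maximization is required only for C>0; for C=0, P(0)=0 need only be a limit of prices doing at least as well as any given price. Markup and passthrough are stated for 0<C≤C^h. *)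

(* Defs.v *)
(* MathComp-Analysis, over an arbitrary realType. *)
From HB Require Import structures.
From mathcomp Require Import all_boot all_order all_algebra.
From mathcomp Require Import all_classical all_reals all_analysis.
Import Order.TTheory GRing.Theory Num.Theory.
Import numFieldNormedType.Exports.
Set Implicit Arguments.
Unset Strict Implicit.
Unset Printing Implicit Defensive.
Local Open Scope classical_set_scope.
Local Open Scope ring_scope.

(* One-sided at those boundary points of A that belong to A. *)
Definition is_derive_within (R : realType) (A : set R) (f : R -> R) (x l : R)
    : Prop :=
  (fun y => (f y - f x) / (y - x)) @ within A x^' --> l.

Definition twice_derivable_on (R : realType) (A : set R) (f : R -> R) : Prop :=
  exists f1 f2 : R -> R, forall x, A x ->
    is_derive_within A f x (f1 x) /\ is_derive_within A f1 x (f2 x).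

(* Only the values of F on [0, Mh] are constrained; see fairness_factor. *)
Record fairness_function (R : realType) (eps Mh : R) (F : R -> R) : Prop := {
  fair_twice_derivable : twice_derivable_on `[0, Mh] F ;
  fair_pos : forall m, 0 <= m < Mh -> 0 < F m ;
  fair_decreasing : forall m m', 0 <= m -> m < m' -> m' <= Mh -> F m' < F m ;
  fair_concave : convex_function `[0, Mh] (fun m => - F m : R^o) ;
  fair_Mh : F Mh = 0 ;
  fair_Mh_large : eps / (eps - 1) < Mh }.

Definition fairness_factor (R : realType) (Mh : R) (F : R -> R) (m : \bar R)
    : R :=
  if (m <= Mh%:E)%E then F (fine m) else 0.

(* The perceived markup is infinite as soon as the perceived cost is zero,
   whatever the price (price zero included); in MathComp x / 0 = 0. *)
Definition perceived_markup (R : realType) (Cp : R -> R) (p : R) : \bar R :=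
  if Cp p == 0 then +oo%E else (p / Cp p)%:E.

Definition utility (R : realType) (eps W f p y : R) : R :=
  eps / (eps - 1) * (f * y) `^ ((eps - 1) / eps) + W - p * y.

Definition optimal_quantity (R : realType) (eps W f p y : R) : Prop :=
  0 <= y /\ forall y', 0 <= y' -> utility eps W f p y' <= utility eps W f p y.

Definition profit (R : realType) (Yd : R -> R) (C p : R) : R := (p - C) * Yd p.

Definition best_price (R : realType) (Yd : R -> R) (C p : R) : Prop :=
  0 <= p /\ forall q, 0 <= q -> profit Yd C q <= profit Yd C p.

(* No best price exists, but prices arbitrarily close to p do at least as well
   as any given price: p is the limit of a profit-maximizing sequence. *)
Definition limit_best_price (R : realType) (Yd : R -> R) (C p : R) : Prop :=
  [/\ 0 <= p,
      ~ (exists q, best_price Yd C q) &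
      forall q d, 0 <= q -> 0 < d ->
        exists2 r, 0 <= r /\ `|r - p| < d & profit Yd C q <= profit Yd C r].

(* Pure-strategy perfect Bayesian equilibrium, where Phi maps the perceived
   markup to the fairness factor.  Strategies and beliefs are total functions
   whose values outside [0, Ch], resp. [0, +oo[, are irrelevant.

   pbe_price: a type C > 0 maximizes its profits exactly.  The single type
   C = 0, which has probability zero under a non-atomistic prior, is allowed a
   limiting maximizer when it has no maximizer: at zero marginal cost,
   isoelastic demand yields the profits p ^ (1 - eps) * F ^ (eps - 1), which
   increase without bound as p tends to 0.

   pbe_correct: beliefs being deterministic, they are correct at an on-path
   price when the perceived cost is the cost of every type charging it. *)
Record pbe (R : realType) (eps W Ch : R) (Phi : \bar R -> R)
    (P Cp Yd : R -> R) : Prop := {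
  pbe_price_ge0 : forall C, 0 <= C <= Ch -> 0 <= P C ;
  pbe_belief_in : forall p, 0 <= p -> 0 <= Cp p <= Ch ;
  pbe_demand : forall p, 0 <= p ->
    optimal_quantity eps W (Phi (perceived_markup Cp p)) p (Yd p) ;
  pbe_price : forall C, 0 <= C <= Ch ->
    best_price Yd C (P C) \/ (C = 0 /\ limit_best_price Yd C (P C)) ;
  pbe_correct : forall p C, 0 <= p -> 0 <= C <= Ch -> P C = p -> Cp p = C }.

(* Monopoly pricing when the fairness factor is identically 1.  At price 0 the
   customer then has no optimal quantity, so the quantity sold at price 0 is
   an arbitrary nonnegative number. *)
Record no_fairness_pricing (R : realType) (eps W Ch : R) (P Yd : R -> R)
    : Prop := {
  nf_demand_ge0 : forall p, 0 <= p -> 0 <= Yd p ;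
  nf_demand : forall p, 0 < p -> optimal_quantity eps W 1 p (Yd p) ;
  nf_price : forall C, 0 < C <= Ch -> best_price Yd C (P C) }.

Definition markup (R : realType) (P : R -> R) (C : R) : R := P C / C.

(* d ln P / d ln C, differentiating t |-> ln (P (exp t)) at t = ln C; the
   derivative is one-sided at C = Ch, where the domain of P ends. *)
Definition is_passthrough (R : realType) (Ch : R) (P : R -> R) (C beta : R)
    : Prop :=
  is_derive_within [set t | expR t <= Ch] (fun t => ln (P (expR t)))
    (ln C) beta.

Definition nonatomic_prior (R : realType) (Ch : R)
    (mu : probability (measurableTypeR R) R) : Prop :=
  mu `[0, Ch]%classic = 1%E /\ forall c : R, mu [set c] = 0%E.

(* Main.v *)
Require Import Defs.
From HB Require Import structures.
From mathcomp Require Import all_boot all_order all_algebra.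
From mathcomp Require Import all_classical all_reals all_analysis.
From mathcomp Require Import ring lra.
Import Order.TTheory GRing.Theory Num.Theory.
Import numFieldNormedType.Exports.
Local Open Scope classical_set_scope.
Local Open Scope ring_scope.

(** The strict Bernoulli inequality [x ^ a < a x + 1 - a] for exponents
    [0 < a < 1] makes the isoelastic demand [f ^ (eps - 1) * p ^ (- eps)] the
    unique optimum of the customer; its version for exponents above 1 makes
    [eps / (eps - 1) * C] the unique maximizer of [(p - C) * p ^ (- eps)].

    If customers believe that the cost is [p / m], where
    [m = eps / (eps - 1)], at every price [p <= m Ch], they perceive the
    constant markup [m < Mh] at all positive on-path prices, so that demand is
    the no-fairness demand up to the constant [F m ^ (eps - 1) > 0].  Prices
    above [m Ch] are deterred by the off-path belief that the cost is zero,
    which makes the fairness factor, hence demand, vanish. *)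

(** * Strict Bernoulli inequalities for real exponents *)

Lemma powR_lt_tangent (R : realType) (a x : R) :
  0 < a < 1 -> 0 <= x -> x != 1 -> x `^ a < a * x + (1 - a).
Proof.
move=> /andP[a0 a1]; rewrite le0r => /orP[/eqP ->|x0 x1].
  by move=> _; rewrite powR0 ?gt_eqF// mulr0 add0r subr_gt0.
have lnx : ln x != 0 by rewrite ln_eq0.
rewrite {1}/powR gt_eqF//; set u := a * ln x.
(* Both [x] and [1] lie strictly above the tangent of [expR] at [u]. *)
have tangent v : v != u -> expR u * (1 + (v - u)) < expR v.
  move=> vu; have /expR_gt1Dx : v - u != 0 by rewrite subr_eq0.
  by rewrite -(ltr_pM2l (expR_gt0 u)) -expRD (addrC u) subrK.
have := tangent (ln x); have := tangent 0.
rewrite lnK ?posrE// expR0.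
have u0 : 0 != u by rewrite eq_sym mulf_neq0// gt_eqF.
have ux : ln x != u.
  by rewrite -subr_eq0 -{1}(mul1r (ln x)) -mulrBl mulf_neq0// gt_eqF// subr_gt0.
move=> /(_ u0) h1 /(_ ux) h2.
have a1' : 0 < 1 - a by rewrite subr_gt0.
(* Since [u = a * ln x + (1 - a) * 0], the linear terms of the two tangent values cancel under the
   weights [a] and [1 - a]. *)
have -> : expR u = a * (expR u * (1 + (ln x - u)))
    + (1 - a) * (expR u * (1 + (0 - u))) by rewrite /u; ring.
by rewrite ltrD ?ltr_pM2l// -[ltRHS]mulr1 ltr_pM2l.
Qed.

(** This is [powR_lt_tangent] with exponent [b^-1] at the point [x ^ b], multiplied through by
    [b]. *)
Lemma powR_gt_tangent (R : realType) (b x : R) :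
  1 < b -> 0 <= x -> x != 1 -> b * x + (1 - b) < x `^ b.
Proof.
move=> b1 x0 x1; have b0 : 0 < b by exact: lt_trans b1.
have xbV : (x `^ b) `^ b^-1 = x by rewrite -powRrM divff ?gt_eqF// powRr1.
have := @powR_lt_tangent _ b^-1 (x `^ b).
rewrite xbV invr_gt0 b0 invf_lt1// b1 powR_ge0 => /(_ isT isT).
have xb1 : x `^ b != 1.
  by apply: contra_neq x1 => e; rewrite -xbV e powR1.
move=> /(_ xb1); rewrite -(ltr_pM2l b0) mulrDr mulrA divff ?gt_eqF// mul1r.
by rewrite mulrBr mulr1 divff ?gt_eqF// => h; lra.
Qed.

(** * Profits under isoelastic demand *)

Lemma mulr_powRN (R : realType) (p e : R) :
  0 < p -> p * p `^ (- e) = p `^ (1 - e).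
Proof.
by move=> p0; rewrite powRD ?(lt0r_neq0 p0) ?implybT// powRr1 ?ltW.
Qed.

(** Serves the type with zero cost: its profits are proportional to revenue, so undercutting any
    positive price pays. *)
Lemma mulr_powRN_lt (R : realType) (e p q : R) :
  1 < e -> 0 < p -> p < q -> q * q `^ (- e) < p * p `^ (- e).
Proof.
move=> e1 p0 pq; have q0 := lt_trans p0 pq.
rewrite !mulr_powRN// -opprB !powRN ltf_pV2 ?posrE ?powR_gt0//.
by rewrite gt0_ltr_powR ?subr_gt0// nnegrE ltW.
Qed.

(** With [p] the claimed maximizer and [x = q / p], the ratio of the two profits is
    [(eps * x + (1 - eps)) * x ^ (- eps)], which is below [1] by Bernoulli with exponent [eps]. *)
Lemma isoelastic_profit_lt (R : realType) (eps C q : R) :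
  1 < eps -> 0 < C -> 0 < q -> q != eps / (eps - 1) * C ->
  (q - C) * q `^ (- eps) <
  (eps / (eps - 1) * C - C) * (eps / (eps - 1) * C) `^ (- eps).
Proof.
move=> e1 C0 q0 qp; have e0 : 0 < eps by exact: lt_trans e1.
have e10 : 0 < eps - 1 by rewrite subr_gt0.
have p0 : 0 < eps / (eps - 1) * C by rewrite mulr_gt0 ?divr_gt0.
set p := eps / (eps - 1) * C in qp p0 *.
have CE : C = p * (eps - 1) / eps by rewrite /p; field; rewrite !gt_eqF.
clearbody p.
have x0 : 0 < q / p by rewrite divr_gt0.
have x1 : q / p != 1.
  by apply: contra_neq qp => e; rewrite -(divfK (lt0r_neq0 p0) q) e mul1r.
have qE : q = q / p * p by rewrite divfK ?gt_eqF.
set x := q / p in x0 x1 qE; clearbody x; rewrite qE powRM ?ltW// CE.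
have -> : (p - p * (eps - 1) / eps) * p `^ (- eps) =
    p / eps * p `^ (- eps) * (x `^ eps * x `^ (- eps)).
  by rewrite (powRN x) divff ?gt_eqF ?powR_gt0//; field; rewrite gt_eqF.
have -> : (x * p - p * (eps - 1) / eps) * (x `^ (- eps) * p `^ (- eps)) =
    p / eps * p `^ (- eps) * ((eps * x + (1 - eps)) * x `^ (- eps)).
  by field; rewrite gt_eqF.
rewrite ltr_pM2l; last by rewrite mulr_gt0 ?powR_gt0// divr_gt0.
rewrite ltr_pM2r ?powR_gt0//; apply: powR_gt_tangent => //; exact: ltW.
Qed.

(** * The customer's problem *)

Definition isoelastic_demand {R : realType} (eps f p : R) : R :=
  f `^ (eps - 1) * p `^ (- eps).

(** The first-order condition at the optimum [s] reads [(f * s) ^ ((eps - 1) / eps) = p * s]. With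
    [x = y / s], the utility lost is then a positive multiple of the Bernoulli gap at [x] with
    exponent [(eps - 1) / eps]. *)
Lemma utility_lt (R : realType) (eps W f p y : R) :
  1 < eps -> 0 < f -> 0 < p -> 0 <= y -> y != isoelastic_demand eps f p ->
  utility eps W f p y < utility eps W f p (isoelastic_demand eps f p).
Proof.
move=> e1 f0 p0 y0 ys; have e0 : 0 < eps by exact: lt_trans e1.
have e10 : 0 < eps - 1 by rewrite subr_gt0.
have s0 : 0 < isoelastic_demand eps f p by rewrite mulr_gt0 ?powR_gt0.
have fsE : (f * isoelastic_demand eps f p) `^ ((eps - 1) / eps) =
    p * isoelastic_demand eps f p.
  rewrite /isoelastic_demand mulrA mulr_powRB1 ?ltW// mulrCA mulr_powRN//.
  rewrite powRM ?powR_ge0// -!powRrM; congr (_ `^ _ * _ `^ _);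
    by field; rewrite gt_eqF.
set s := isoelastic_demand eps f p in ys s0 fsE *.
have x1 : y / s != 1.
  by apply: contra_neq ys => e; rewrite -(divfK (lt0r_neq0 s0) y) e mul1r.
have x0 : 0 <= y / s by rewrite divr_ge0// ltW.
have yE : y = y / s * s by rewrite divfK ?gt_eqF.
set x := y / s in x0 x1 yE; clearbody x s; rewrite yE /utility (mulrC x) (mulrA f) (mulrA p).
have fs0 : 0 <= f * s by rewrite ltW// mulr_gt0.
rewrite (powRM _ fs0 x0) fsE -subr_gt0.
have /(powR_lt_tangent _ _ _)/(_ x0 x1) : 0 < (eps - 1) / eps < 1.
  by rewrite divr_gt0// ltr_pdivrMr// mul1r gtrBl ltr01.
rewrite -subr_gt0 => h.
set xa := x `^ _ in h *.
have -> : eps / (eps - 1) * (p * s) + W - p * s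
    - (eps / (eps - 1) * (p * s * xa) + W - p * s * x) =
    p * s * (eps / (eps - 1)) *
      ((eps - 1) / eps * x + (1 - (eps - 1) / eps) - xa).
  by field; rewrite !gt_eqF.
by rewrite !mulr_gt0 ?invr_gt0.
Qed.

Lemma isoelastic_demand_optimal (R : realType) (eps W f p : R) :
  1 < eps -> 0 < f -> 0 < p ->
  optimal_quantity eps W f p (isoelastic_demand eps f p).
Proof.
move=> e1 f0 p0; split=> [|y y0]; first by rewrite mulr_ge0 ?powR_ge0.
by have [->//|ys] := eqVneq y (isoelastic_demand eps f p); exact/ltW/utility_lt.
Qed.

Lemma optimal_quantity_unique (R : realType) (eps W f p y : R) :
  1 < eps -> 0 < f -> 0 < p -> optimal_quantity eps W f p y ->
  y = isoelastic_demand eps f p.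
Proof.
move=> e1 f0 p0 [y0 ymax]; apply/eqP; apply: contraT => ys.
have := ymax _ (isoelastic_demand_optimal _ eps W f p e1 f0 p0).1.
by rewrite leNgt utility_lt.
Qed.

Lemma optimal_quantity0 (R : realType) (eps W p : R) :
  1 < eps -> 0 <= p -> optimal_quantity eps W 0 p 0.
Proof.
move=> e1 p0; split=> // y y0; have e0 : 0 < eps by exact: lt_trans e1.
have a0 : (eps - 1) / eps != 0 by rewrite gt_eqF// divr_gt0 ?subr_gt0.
by rewrite /utility !mul0r powR0// !mulr0 lerD2l lerN2 mulr_ge0.
Qed.

(** * Passthrough of proportional prices, and the range of costs *)

Lemma passthrough_proportional (R : realType) (Ch m C : R) (P : R -> R) :
  0 < m -> 0 < C <= Ch -> (forall c, 0 < c <= Ch -> P c = m * c) ->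
  is_passthrough Ch P C 1.
Proof.
move=> m0 /andP[C0 CCh] PE; rewrite /is_passthrough /is_derive_within.
have lnPE t : expR t <= Ch -> ln (P (expR t)) = ln m + t.
  by move=> tCh; rewrite PE ?expR_gt0// lnM ?posrE ?expR_gt0// expRK.
(* In logarithms a proportional price is a translation, so the difference quotient is constantly
   [1]. *)
apply: cvg_near_cst; rewrite near_withinE; near=> t => tCh.
have tlnC : t != ln C by near: t; exact: nbhs_dnbhs_neq.
rewrite lnPE// lnPE ?lnK ?posrE//.
have -> : ln m + t - (ln m + ln C) = t - ln C by ring.
by rewrite divff// subr_eq0.
Unshelve. all: by end_near.
Qed.

(** Otherwise [[0, Ch]] would lie in the single point [0] and carry no mass. *)
Lemma nonatomic_prior_gt0 (R : realType) (Ch : R)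
    (mu : probability (measurableTypeR R) R) :
  nonatomic_prior Ch mu -> 0 < Ch.
Proof.
move=> [mu1 mu0]; rewrite ltNge; apply/negP => Ch0.
have sub0 : `[0, Ch]%classic `<=` [set (0 : R)].
  move=> x /=; rewrite in_itv/= => /andP[x0 xCh].
  by apply/eqP; rewrite eq_le x0 (le_trans xCh).
have : (1%:E <= 0%:E :> \bar R)%E.
  rewrite -{1}mu1 -[X in (_ <= X)%E](mu0 0).
  exact: (le_measure mu (mem_set (measurable_itv `[0, Ch]))
    (mem_set (measurable_set1 0)) sub0).
by rewrite lee_fin ler10.
Qed.

(** * The benchmark without fairness concerns *)

Lemma no_fairness_pricing_price (R : realType) (eps W Ch : R) (P Yd : R -> R) :
  1 < eps -> no_fairness_pricing eps W Ch P Yd ->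
  forall C, 0 < C <= Ch -> P C = eps / (eps - 1) * C.
Proof.
move=> e1 [Y0 Yopt Pbest] C CCh; have /andP[C0 _] := CCh.
have e0 : 0 < eps by exact: lt_trans e1.
have e10 : 0 < eps - 1 by rewrite subr_gt0.
have YdE p : 0 < p -> Yd p = p `^ (- eps).
  move=> p0; rewrite (optimal_quantity_unique _ _ _ _ _ _ e1 ltr01 p0 (Yopt _ p0))//.
  by rewrite /isoelastic_demand powR1 mul1r.
have mC0 : 0 < eps / (eps - 1) * C by rewrite mulr_gt0 ?divr_gt0.
have [P0 Pmax] := Pbest _ CCh; have := Pmax _ (ltW mC0).
apply: contraTeq => PC; rewrite -ltNge /profit (YdE _ mC0).
move: P0; rewrite le0r => /orP[/eqP P0|P0]; last first.
  by rewrite YdE//; exact: isoelastic_profit_lt.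
(* At price [0] only the sign of the quantity is known. This bounds profits there by [0], while the
   claimed price earns strictly more. *)
rewrite P0 (@le_lt_trans _ _ 0) ?sub0r ?mulNr ?oppr_le0 ?mulr_ge0 ?Y0// ?ltW//.
have -> : eps / (eps - 1) * C - C = C / (eps - 1) by field; rewrite gt_eqF.
by rewrite mulr_gt0 ?powR_gt0 ?divr_gt0.
Qed.

Lemma no_fairness_pricing_markup (R : realType) (eps W Ch : R) :
  1 < eps -> no_fairness_pricing eps W Ch (fun C => eps / (eps - 1) * C)
    (isoelastic_demand eps 1).
Proof.
move=> e1; have e0 : 0 < eps by exact: lt_trans e1.
have e10 : 0 < eps - 1 by rewrite subr_gt0.
split=> [p p0|p p0|C /andP[C0 _]].
- by rewrite mulr_ge0 ?powR_ge0.
- exact: isoelastic_demand_optimal.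
have mC0 : 0 < eps / (eps - 1) * C by rewrite mulr_gt0 ?divr_gt0.
split=> [|q]; first exact: ltW.
rewrite /profit /isoelastic_demand powR1 !mul1r le0r => /orP[/eqP ->|q0].
  (* By convention [0] to a nonzero power, even a negative one, is [0]: nothing is sold at price
     [0]. *)
  rewrite powR0 ?oppr_eq0 ?gt_eqF// mulr0.
  have -> : eps / (eps - 1) * C - C = C / (eps - 1) by field; rewrite gt_eqF.
  by rewrite mulr_ge0 ?powR_ge0// divr_ge0 ?ltW.
have [->//|qC] := eqVneq q (eps / (eps - 1) * C).
exact/ltW/isoelastic_profit_lt.
Qed.

(** * The separating equilibrium *)

Definition separating_belief {R : realType} (m Ch p : R) : R :=
  if p <= m * Ch then p / m else 0.

(** Price [0] joins the deterred prices: its perceived cost is [0], so its perceived markup is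
    infinite. *)
Lemma fairness_factor_separating (R : realType) (Mh m Ch p : R) (F : R -> R) :
  0 < m -> m <= Mh -> 0 <= p ->
  fairness_factor Mh F (perceived_markup (separating_belief m Ch) p) =
  if 0 < p <= m * Ch then F m else 0.
Proof.
move=> m0 mMh p0; rewrite /fairness_factor /perceived_markup /separating_belief.
have [_|_] := leP p (m * Ch); rewrite ?andbT ?andbF ?eqxx//=.
move: p0; rewrite le0r => /orP[/eqP ->|p0]; first by rewrite mul0r eqxx ltxx.
rewrite gt_eqF ?divr_gt0// p0 /=.
have -> : p / (p / m) = m by field; rewrite !gt_eqF.
by rewrite lee_fin mMh.
Qed.

Lemma separating_pbe (R : realType) (eps W Ch Mh : R) (F : R -> R) :
  1 < eps -> 0 < Ch -> eps / (eps - 1) <= Mh -> 0 < F (eps / (eps - 1)) ->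
  let m := eps / (eps - 1) in
  let Cp := separating_belief m Ch in
  let Phi := fairness_factor Mh F in
  pbe eps W Ch Phi (fun C => m * C) Cp
    (fun p => isoelastic_demand eps (Phi (perceived_markup Cp p)) p).
Proof.
move=> e1 Ch0 mMh Fm0 m Cp Phi; rewrite -/m in mMh Fm0.
have e0 : 0 < eps by exact: lt_trans e1.
have e10 : 0 < eps - 1 by rewrite subr_gt0.
have m0 : 0 < m by rewrite divr_gt0.
have PhiE p : 0 <= p ->
    Phi (perceived_markup Cp p) = if 0 < p <= m * Ch then F m else 0.
  exact: fairness_factor_separating.
have d0 p : isoelastic_demand eps 0 p = 0.
  by rewrite /isoelastic_demand powR0 ?mul0r// gt_eqF.
set K := F m `^ (eps - 1); have K0 : 0 < K by rewrite powR_gt0.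
set Yd := (X in pbe _ _ _ _ _ _ X).
have YdE p : 0 < p <= m * Ch -> Yd p = K * p `^ (- eps).
  by move=> h; have /andP[/ltW p0 _] := h; rewrite /Yd PhiE// h.
have Yd0 p : 0 <= p -> ~~ (0 < p <= m * Ch) -> Yd p = 0.
  by move=> p0 /negbTE h; rewrite /Yd PhiE// h.
have zero_profit p : 0 < p <= m * Ch -> profit Yd 0 p = K * (p * p `^ (- eps)).
  by move=> h; rewrite /profit YdE// subr0 mulrCA.
split.
- by move=> C /andP[C0 _]; rewrite mulr_ge0// ltW.
- move=> p p0; rewrite /Cp /separating_belief; case: ifPn => pm.
    by rewrite divr_ge0 ?(ltW m0)//= ler_pdivrMr// mulrC.
  by rewrite lexx ltW.
- move=> p p0; rewrite /Yd PhiE//; case: ifPn => [/andP[p1 _]|_].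
    exact: isoelastic_demand_optimal.
  by rewrite d0; exact: optimal_quantity0.
- move=> C /andP[]; rewrite le0r => /orP[/eqP -> _|C0 CCh]; [right|left].
    split=> //; rewrite mulr0; split=> //.
      (* The zero-cost type has no best price: a [q] without sales loses to [m * Ch], and any other
         [q] loses to [q / 2]. *)
      case=> q [q0 qmax]; have mCh0 : 0 < m * Ch by rewrite mulr_gt0.
      have [qon|qoff] := boolP (0 < q <= m * Ch); last first.
        have := qmax _ (ltW mCh0); rewrite zero_profit ?mCh0 ?lexx//.
        rewrite /profit (Yd0 q)// mulr0 leNgt.
        by rewrite mulr_gt0// mulr_gt0// powR_gt0.
      have /andP[qgt0 qle] := qon.
      have h2 : 0 < q / 2 by rewrite divr_gt0.
      have hq : q / 2 < q by lra.
      have := qmax _ (ltW h2); rewrite !zero_profit ?h2 ?(le_trans (ltW hq))//.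
      by rewrite ler_pM2l// leNgt mulr_powRN_lt.
    (* Price [0] matches a [q] without sales. Against any other [q], a positive price at most [q]
       and below [d] does at least as well. *)
    move=> q d q0 dgt0; have [qon|qoff] := boolP (0 < q <= m * Ch); last first.
      exists 0; first by rewrite subrr normr0.
      by rewrite /profit (Yd0 q)// mulr0 subrr mul0r.
    have /andP[qgt0 qle] := qon.
    have [r [r0 rq rd]] : exists r, [/\ 0 < r, r <= q & r < d].
      exists (Num.min q (d / 2)); rewrite lt_min ge_min gt_min qgt0 lexx.
      by split=> //; [lra | apply/orP; right; lra].
    exists r; first by rewrite subr0 gtr0_norm//; split=> //; exact: ltW.
    rewrite !zero_profit ?r0 ?(le_trans rq)// ler_pM2l//.
    have [->//|rq'] := eqVneq r q.
    by apply/ltW/mulr_powRN_lt => //; rewrite lt_neqAle rq' rq.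
  have mC0 : 0 < m * C by rewrite mulr_gt0.
  split=> [|q q0]; first exact: ltW.
  rewrite {2}/profit YdE ?mC0 ?ler_pM2l//.
  have [qon|qoff] := boolP (0 < q <= m * Ch); last first.
    rewrite /profit Yd0// mulr0 mulr_ge0 ?mulr_ge0 ?powR_ge0 ?(ltW K0)//.
    have -> : m * C - C = C / (eps - 1) by rewrite /m; field; rewrite gt_eqF.
    by rewrite divr_ge0 ?ltW.
  (* The constant [K] cancels, which leaves the comparison of profits without fairness. *)
  rewrite /profit YdE// 2![_ * (K * _)]mulrCA ler_pM2l//.
  have [->//|qC] := eqVneq q (m * C).
  by apply/ltW/isoelastic_profit_lt => //; case/andP: qon.
- move=> p C p0 /andP[C0 CCh] <-.
  by rewrite /Cp /separating_belief ler_pM2l// CCh mulrC mulKf ?gt_eqF.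
Qed.

Theorem lemma4 (R : realType) (eps W Ch Mh : R) (F : R -> R)
    (prior : probability (measurableTypeR R) R)
    (heps : 1 < eps) (hW : 0 < W)
    (hF : fairness_function eps Mh F)
    (hprior : nonatomic_prior Ch prior) :
  exists P Cp Yd : R -> R,
    [/\ pbe eps W Ch (fairness_factor Mh F) P Cp Yd,
        (forall C, 0 <= C <= Ch -> P C = eps / (eps - 1) * C),
        (forall C, 0 <= C <= Ch -> Cp (P C) = C),
        (forall C, 0 < C <= Ch ->
           markup P C = eps / (eps - 1) /\ is_passthrough Ch P C 1) &
        (exists P0 Y0 : R -> R, no_fairness_pricing eps W Ch P0 Y0) /\
        (forall P0 Y0 : R -> R, no_fairness_pricing eps W Ch P0 Y0 ->
           forall C, 0 < C <= Ch ->
             [/\ markup P0 C = eps / (eps - 1), is_passthrough Ch P0 C 1 &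
                 markup P C = markup P0 C])].
Proof.
have Ch0 := nonatomic_prior_gt0 _ _ _ hprior.
have m0 : 0 < eps / (eps - 1) by rewrite divr_gt0 ?subr_gt0// (lt_trans ltr01).
have mMh := fair_Mh_large hF.
have Fm0 : 0 < F (eps / (eps - 1)) by apply: (fair_pos hF); rewrite ltW.
have eqm := separating_pbe _ _ W _ _ _ heps Ch0 (ltW mMh) Fm0.
have markupE P C : 0 < C <= Ch -> P C = eps / (eps - 1) * C ->
    markup P C = eps / (eps - 1).
  by move=> /andP[C0 _] PC; rewrite /markup PC mulfK ?gt_eqF.
eexists _, _, _; split; first exact: eqm.
- by [].
- move=> C CCh; apply: (pbe_correct eqm) => //.
  by case/andP: CCh => C0 _; rewrite mulr_ge0// ltW.
- move=> C CCh; split; first exact: markupE.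
  exact: (passthrough_proportional _ _ _ _ _ m0 CCh).
(* Exhibiting a benchmark keeps the comparison with all benchmarks from being vacuous. *)
- split; first by eexists _, _; exact: no_fairness_pricing_markup.
  move=> P0 Y0 nf C CCh.
  have P0E := no_fairness_pricing_price _ _ _ _ _ _ heps nf.
  have P0C := P0E _ CCh.
  split; first exact: markupE.
    exact: (passthrough_proportional _ _ _ _ _ m0 CCh P0E).
  by rewrite !markupE.
Qed.
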